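(* Let $X$ and $Y$ be bounded geometry metric spaces, and let $A[X]$ and $A[Y]$ be algebraic Roe-type algebras associated to $X$ and $Y$ respectively. If there exists a $*$-isomorphism $\phi:A[X]\to A[Y]$, then $X$ and $Y$ are coarsely equivalent.
   Context: A metric space $X$ has bounded geometry if for all $R\ge 0$ there is $N_R\in\mathbb{N}$ such that every ball of radius $R$ in $X$ has at most $N_R$ elements. A (not necessarily continuous) map $f:X\to Y$ of metric spaces is uniformly expansive if for all $R>0$ there is $S>0$ such that $d(x_1,x_2)\le R$ implies $d(f(x_1),f(x_2))\le S$. Two maps $f,g:X\to Y$ are close if there is $C>0$ with $d(f(x),g(x))\le C$ for all $x\in X$. $X$ and $Y$ are coarsely equivalent if there are uniformly expansive maps $f:X\to Y$ and $g:Y\to X$ such that $f\circ g$ and $g\circ f$ are close to the identity maps on $Y$ and $X$ respectively. Algebraic Roe-type algebras: let $\mathcal{H}$ be a (nonzero, possibly finite dimensional) separable complex Hilbert space; the Hilbert spaces used for $X$ and for $Y$ may differ. For a bounded operator $T$ on $l^2(X,\mathcal{H})\cong l^2(X)\otimes\mathcal{H}$ write $T_{xy}$ for its $(x,y)$ matrix coefficient, a bounded operator on $\mathcal{H}$. $T$ has finite propagation if there is $S>0$ such that $T_{xy}=0$ whenever $d(x,y)\ge S$; $T$ is locally compact if every $T_{xy}$ is compact. A $*$-subalgebra of $\mathcal{B}(l^2(X,\mathcal{H}))$ is an algebraic Roe-type algebra associated to $X$ if it consists only of locally compact, finite propagation operators, and it contains every finite propagation operator $T$ for which there is $N\in\mathbb{N}$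 with $\mathrm{rank}(T_{xy})\le N$ for all $x,y\in X$. *)

(* Defs.v *)
From HB Require Import structures.
From mathcomp Require Import all_boot all_order all_algebra complex.
From mathcomp Require Import boolp classical_sets functions cardinality.
From mathcomp Require Import fsbigop reals ereal topology normedtype numfun esum.
From mathcomp Require Import lra.

Set Implicit Arguments.
Unset Strict Implicit.
Unset Printing Implicit Defensive.

Import Order.TTheory GRing.Theory Num.Theory Num.Def.
Import numFieldTopology.Exports numFieldNormedType.Exports.

Local Open Scope classical_set_scope.
Local Open Scope ring_scope.

Section CauchySchwarz.
Variables (C : numClosedFieldType) (U : lmodType C) (form : {dot U for conjC}).

Let aux (e c d : C) : 0 < d ->
  0 <= e + `|c / d| ^+ 2 * d - ((c / d)^* * c + ((c / d)^* * c)^*) ->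
  `|c| ^+ 2 <= e * d.
Proof.
move=> d0; have dn : d != 0 by rewrite gt_eqF.
have dr : d^* = d by rewrite conj_Creal// gtr0_real.
have -> : (c / d)^* * c = `|c| ^+ 2 / d.
  by rewrite rmorphM/= fmorphV/= dr normCK mulrAC (mulrC c).
rewrite rmorphM/= fmorphV/= dr rmorphXn/= (conj_Creal (normr_real c)).
have -> : `|c / d| ^+ 2 * d = `|c| ^+ 2 / d.
  by rewrite normrM normfV (gtr0_norm d0) exprMn (expr2 d^-1) -!mulrA mulVf ?mulr1.
rewrite opprD addrA addrK subr_ge0.
by rewrite ler_pdivrMr.
Qed.

Lemma dot_CauchySchwarz (u v : U) :
  `|form u v| <= sqrtC (form u u) * sqrtC (form v v).
Proof.
have [->|v0] := eqVneq v 0.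
  by rewrite !linear0r normr0 sqrtC0 mulr0.
have vv : 0 < form v v by rewrite dnorm_gt0.
suff H : `|form u v| ^+ 2 <= form u u * form v v.
  rewrite -sqrtCM ?qualifE/= ?dnorm_ge0//.
  rewrite -[`|form u v|]sqrCK; last exact: normr_ge0.
  by rewrite ler_sqrtC ?nnegrE ?exprn_ge0 ?mulr_ge0 ?dnorm_ge0.
have := dnorm_ge0 form (u - (form u v / form v v) *: v).
rewrite dnormB dnormZ linearZr_LR/= => H; exact: (aux vv H).
Qed.

Lemma dot_sqrtD (u v : U) :
  sqrtC (form (u + v) (u + v)) <= sqrtC (form u u) + sqrtC (form v v).
Proof.
rewrite -(@ler_pXn2r _ 2)// ?nnegrE ?addr_ge0 ?sqrt_dnorm_ge0//.
rewrite sqrtCK dnormD sqrrD !sqrtCK [leRHS]addrAC lerD2l.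
rewrite (@le_trans _ _ (`|form u v + (form u v)^*|))//.
  by rewrite real_ler_norm// CrealE rmorphD/= conjCK addrC.
rewrite (le_trans (ler_normD _ _))// norm_conjC mulr2n lerD//; exact: dot_CauchySchwarz.
Qed.
End CauchySchwarz.

(* The norm and topology are those of a normed module over R[i] (so `|u| lies
   in R[i]); inner products are linear in the first argument. *)
HB.mixin Record NormedModule_isInner (R : realType) H
    & NormedModule R[i] H := {
  inner : {dot H for (@conjC R[i])} ;
  inner_norm : forall u : H, inner u u = `|u| ^+ 2 }.

#[short(type="innerType")]
HB.structure Definition Inner (R : realType) :=
  {H of NormedModule R[i] H & NormedModule_isInner R H}.

#[short(type="hilbertType")]
HB.structure Definition Hilbert (R : realType) :=
  {H of Inner R H & CompleteNormedModule R[i] H}.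

HB.factory Record Lmodule_isInner (R : realType) H & GRing.Lmodule R[i] H := {
  inner : {dot H for (@conjC R[i])} }.

HB.builders Context R H & Lmodule_isInner R H.

Let nrm (u : H) : R[i] := sqrtC (inner u u).

Let nrmZ (l : R[i]) (x : H) : nrm (l *: x) = `|l| * nrm x.
Proof.
by rewrite /nrm dnormZ sqrtCM ?qualifE/= ?exprn_ge0 ?dnorm_ge0// sqrCK.
Qed.

Let nrm_eq0 (x : H) : nrm x = 0 -> x = 0.
Proof. by move/eqP; rewrite /nrm sqrt_dnorm_eq0 => /eqP. Qed.

Let nrmD (x y : H) : nrm (x + y) <= nrm x + nrm y.
Proof. exact: dot_sqrtD. Qed.

HB.instance Definition _ := Lmodule_isNormed.Build R[i] H nrmD nrmZ nrm_eq0.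

Let nrmE (u : H) : inner u u = `|u| ^+ 2.
Proof. by rewrite /Num.norm/= /nrm sqrtCK. Qed.

HB.instance Definition _ := NormedModule_isInner.Build R H nrmE.

HB.end.

Section real_norm.
Context {R : realType} {H : innerType R}.
Implicit Types u v : H.

Definition rnorm u : R := complex.Re `|u|.

Lemma rnormE u : (rnorm u)%:C%C = `|u|.
Proof. by rewrite /rnorm RRe_real// normr_real. Qed.

Lemma rnorm_ge0 u : 0 <= rnorm u.
Proof. by rewrite -ler0c rnormE normr_ge0. Qed.

Lemma rnorm0 : rnorm (0 : H) = 0.
Proof. by apply: complexI; rewrite rnormE normr0. Qed.

Lemma rnorm_eq0 u : rnorm u = 0 -> u = 0.
Proof. by move=> u0; apply/normr0_eq0; rewrite -rnormE u0. Qed.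

Lemma rnormZ (a : R[i]) u : rnorm (a *: u) = complex.Re `|a| * rnorm u.
Proof.
by apply: complexI; rewrite rnormE normrZ rmorphM/= rnormE.
Qed.

Lemma le_rnormD u v : rnorm (u + v) <= rnorm u + rnorm v.
Proof. by rewrite -lecR rmorphD/= !rnormE ler_normD. Qed.

Lemma rnormD_sqr u v :
  rnorm (u + v) ^+ 2 <= 2 * (rnorm u ^+ 2 + rnorm v ^+ 2).
Proof.
rewrite (@le_trans _ _ ((rnorm u + rnorm v) ^+ 2))//.
  by rewrite lerXn2r ?nnegrE ?addr_ge0 ?rnorm_ge0// le_rnormD.
by have := sqr_ge0 (rnorm u - rnorm v); nra.
Qed.

Lemma inner_rnorm u : inner u u = (rnorm u ^+ 2)%:C%C.
Proof. by rewrite inner_norm rmorphXn/= rnormE. Qed.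

Lemma inner_le u v : `|inner u v| <= (rnorm u ^+ 2 + rnorm v ^+ 2)%:C%C.
Proof.
rewrite (le_trans (dot_CauchySchwarz inner u v))// !inner_norm !sqrCK//.
rewrite -!rnormE -rmorphM lecR.
have := (sqr_ge0 (rnorm u), sqr_ge0 (rnorm v), sqr_ge0 (rnorm u - rnorm v)).
by move=> [[]]; nra.
Qed.

Lemma Re_inner_le u v :
  `|complex.Re (inner u v)| <= rnorm u ^+ 2 + rnorm v ^+ 2.
Proof.
by rewrite -lecR (le_trans _ (inner_le u v))// normc_ge_Re.
Qed.

Lemma Im_inner_le u v :
  `|complex.Im (inner u v)| <= rnorm u ^+ 2 + rnorm v ^+ 2.
Proof.
rewrite -lecR (le_trans _ (inner_le u v))//.
rewrite -normrN -ReiNIm (le_trans (normc_ge_Re _))// normrM.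
rewrite [X in _ * X](_ : _ = 1) ?mulr1//.
by rewrite normc_def/= expr0n/= add0r expr1n sqrtr1.
Qed.

End real_norm.

Section sums.
Context {R : realType} {I : choiceType}.
Implicit Types (u v : I -> R) (w z : I -> R[i]).
Local Notation summ u := (summable [set: I] (EFin \o u)).

(* Unordered sum of a family of reals, positive minus negative part; only
   meaningful on summable families. *)
Definition rsum u : R :=
  fine (esum [set: I] (EFin \o u)^\+ - esum [set: I] (EFin \o u)^\-).

Definition csum w : R[i] :=
  Complex (rsum (fun i => complex.Re (w i))) (rsum (fun i => complex.Im (w i))).

Lemma le_summ u v : (forall i, `|u i| <= v i) -> summ v -> summ u.
Proof.
move=> uv; apply: le_lt_trans; apply: le_esum => i _ /=.
by rewrite lee_fin (le_trans (uv i))// ler_norm.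
Qed.

Lemma summD u v : summ u -> summ v -> summ (fun i => u i + v i).
Proof. by move=> su sv; have := summableD su sv. Qed.

Lemma summN u : summ u -> summ (fun i => - u i).
Proof. by rewrite summableN. Qed.

Lemma fin_esum u : summ u -> (forall i, 0 <= u i) ->
  esum [set: I] (EFin \o u) \is a fin_num.
Proof.
move=> su u0; move: su; rewrite summableE; congr (_ \is a fin_num).
by apply: eq_esum => i _ /=; rewrite ger0_norm.
Qed.

Lemma rsumB u v : summ u -> summ v -> (forall i, 0 <= u i) ->
  (forall i, 0 <= v i) ->
  rsum (fun i => u i - v i) =
  fine (esum setT (EFin \o u)) - fine (esum setT (EFin \o v)).
Proof.
move=> su sv u0 v0; rewrite /rsum -fineB ?fin_esum//.
congr fine; have := @esumB R I setT (EFin \o u) (EFin \o v) su sv.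
by apply=> i _; rewrite lee_fin.
Qed.

Let esumfD u v : summ u -> summ v -> (forall i, 0 <= u i) ->
  (forall i, 0 <= v i) ->
  fine (esum setT (EFin \o (fun i => u i + v i))) =
  fine (esum setT (EFin \o u)) + fine (esum setT (EFin \o v)).
Proof.
move=> su sv u0 v0; rewrite -fineD ?fin_esum//.
by congr fine; rewrite -esumD// => i _; rewrite lee_fin.
Qed.

Lemma summ_max u : summ u -> summ (fun i => Num.max (u i) 0).
Proof.
move=> su; apply: (@le_summ _ (fun i => `|u i|)); last first.
  by move: su; rewrite /summable; under eq_esum do rewrite /= -(normr_id (u _)).
by move=> i; rewrite ger0_norm ?le_max ?lexx ?orbT// ge_max normr_ge0 ler_norm.
Qed.

Let posneg u i : u i = Num.max (u i) 0 - Num.max (- u i) 0.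
Proof.
have [h|h] := leP 0 (u i).
  by rewrite max_r ?oppr_le0// subr0.
by rewrite max_l ?oppr_ge0 ?ltW// sub0r opprK.
Qed.

Let mx0 (x : R) : 0 <= Num.max x 0. Proof. by rewrite le_max lexx orbT. Qed.

Lemma rsumD u v : summ u -> summ v ->
  rsum (fun i => u i + v i) = rsum u + rsum v.
Proof.
move=> su sv.
have [Pu Nu] := (summ_max su, summ_max (summN su)).
have [Pv Nv] := (summ_max sv, summ_max (summN sv)).
rewrite [in RHS](funext (posneg u)) [in RHS](funext (posneg v)).
rewrite !rsumB// addrACA -opprD -!esumfD//.
rewrite -rsumB; [|exact: summD|exact: summD|by move=> i; rewrite addr_ge0|by move=> i; rewrite addr_ge0].
congr rsum; apply/funext => i.
by rewrite [in LHS](posneg u) [in LHS](posneg v) opprD addrACA.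
Qed.

Lemma rsumN u : summ u -> rsum (fun i => - u i) = - rsum u.
Proof.
move=> su; have [Pu Nu] := (summ_max su, summ_max (summN su)).
rewrite [in RHS](funext (posneg u)) rsumB// opprB -rsumB//.
by congr rsum; apply/funext => i; rewrite [in LHS](posneg u) opprB.
Qed.

Lemma rsum_ge0 u : (forall i, 0 <= u i) -> summ u ->
  rsum u = fine (esum setT (EFin \o u)).
Proof.
move=> u0 su; have s0 : summ (fun=> 0 : R).
  by rewrite /summable esum1// => i _; rewrite /= normr0.
transitivity (rsum (fun i => u i - 0)); first by congr rsum; apply/funext => i; rewrite subr0.
rewrite rsumB// [X in _ - fine X]esum1 ?subr0// => i _.
Qed.

Lemma esumZ (c : R) u : 0 < c -> (forall i, 0 <= u i) ->
  esum setT (EFin \o (fun i => c * u i)) = (c%:E * esum setT (EFin \o u))%E.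
Proof.
suff H (d : R) (w : I -> R) : 0 < d -> (forall i, 0 <= w i) ->
  (d%:E * esum setT (EFin \o w) <= esum setT (EFin \o (fun i => (d * w i)%R)))%E.
  move=> c0 u0; apply/eqP; rewrite eq_le H// andbT.
  rewrite -[leLHS]mul1e -[1%E]/(1%:E) -(divff (lt0r_neq0 c0)) EFinM -muleA.
  apply: lee_pmul; rewrite ?lee_fin ?(ltW c0)//.
    apply: mule_ge0; first by rewrite lee_fin invr_ge0 ltW.
    by apply: esum_ge0 => i _; rewrite lee_fin mulr_ge0// ltW.
  apply: (le_trans (H _ _ _ _)); [by rewrite invr_gt0| |].
    by move=> i; rewrite mulr_ge0// ltW.
  by apply: le_esum => i _; rewrite /= mulKf// lt0r_neq0.
move=> d0 w0; rewrite muleC -lee_pdivlMr//.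
apply: ge_ereal_sup => _ [X [fX _] <-].
rewrite lee_pdivlMr//; apply: ereal_sup_ubound; exists X; first by split.
rewrite muleC !fsbig_finite//= !sumEFin -EFinM; congr EFin.
by rewrite mulr_sumr.
Qed.

Lemma summZ (c : R) u : summ u -> summ (fun i => c * u i).
Proof.
move=> su; have [->|c0] := eqVneq c 0.
  suff : summ (fun=> 0 : R) by apply: le_summ => i; rewrite mul0r normr0.
  by rewrite /summable esum1// => i _; rewrite /= normr0.
have : (esum [set: I] (EFin \o (fun i => `|c| * `|u i|)%R) < +oo)%E.
  rewrite esumZ ?normr_gt0//.
  by rewrite (@lte_mul_pinfty R)// ?lee_fin.
by apply: le_lt_trans; apply: le_esum => i _; rewrite /= lee_fin normrM.
Qed.

Lemma rsumZ (c : R) u : summ u -> rsum (fun i => c * u i) = c * rsum u.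
Proof.
wlog c0 : c / 0 < c.
  move=> H su; have [c0|c0|<-] := ltgtP 0 c; first exact: H.
    rewrite -[c]opprK mulNr -H ?oppr_gt0// -rsumN; last exact: summZ.
    by congr rsum; apply/funext => i; rewrite mulNr.
  rewrite mul0r; transitivity (rsum (fun i => u i - u i)).
    by congr rsum; apply/funext => i; rewrite mul0r subrr.
  by rewrite (rsumD su (summN su)) rsumN// subrr.
move=> su; have [Pu Nu] := (summ_max su, summ_max (summN su)).
rewrite [in RHS](funext (posneg u)) rsumB// mulrBr.
transitivity (rsum (fun i => c * Num.max (u i) 0 - c * Num.max (- u i) 0)).
  by congr rsum; apply/funext => i; rewrite -mulrBr -posneg.
rewrite rsumB; [|exact: summZ|exact: summZ|by move=> i; rewrite mulr_ge0// ltW|by move=> i; rewrite mulr_ge0// ltW].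
rewrite !esumZ// !fineM ?fin_esum//.
Qed.


Lemma csumZD (a : R[i]) w z :
    summ (fun i => complex.Re (w i)) -> summ (fun i => complex.Im (w i)) ->
    summ (fun i => complex.Re (z i)) -> summ (fun i => complex.Im (z i)) ->
  csum (fun i => a * w i + z i) = a * csum w + csum z.
Proof.
move=> rw iw rz iz; case: a => a b.
have [sr si] := (summN (summZ b iw), summZ b rw).
rewrite /csum; simpc; congr Complex.
  transitivity (rsum (fun i => (a * complex.Re (w i) + - (b * complex.Im (w i)))
                               + complex.Re (z i))).
    by congr rsum; apply/funext => i; case: (w i) (z i) => [? ?] [? ?].
  rewrite (rsumD (summD (summZ a rw) sr) rz) (rsumD (summZ a rw) sr).
  by rewrite (rsumN (summZ b iw)) (rsumZ a rw) (rsumZ b iw).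
transitivity (rsum (fun i => (a * complex.Im (w i) + b * complex.Re (w i))
                             + complex.Im (z i))).
  by congr rsum; apply/funext => i; case: (w i) (z i) => [? ?] [? ?].
rewrite (rsumD (summD (summZ a iw) si) iz) (rsumD (summZ a iw) si).
by rewrite (rsumZ a iw) (rsumZ b rw).
Qed.

Lemma csumJ w : summ (fun i => complex.Im (w i)) ->
  csum (fun i => (w i)^*) = (csum w)^*.
Proof.
move=> iw; rewrite /csum; congr Complex.
  by congr rsum; apply/funext => i; case: (w i).
by rewrite -rsumN//; congr rsum; apply/funext => i; case: (w i).
Qed.

End sums.

Section l2.
Context {R : realType}.

Definition square_summable (X : choiceType) (H : innerType R) : {pred X -> H} :=
  fun f => `[< (\esum_(x in [set: X]) (rnorm (f x) ^+ 2)%:E < +oo)%E >].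

Record l2 (X : choiceType) (H : innerType R) := L2 {
  l2_fun :> X -> H ;
  l2_fun_proof : l2_fun \in @square_summable X H }.

Context {X : choiceType} {H : innerType R}.

HB.instance Definition _ := [isSub for @l2_fun X H].
HB.instance Definition _ := [Choice of l2 X H by <:].

Local Notation summ u := (summable [set: X] (EFin \o u)).

Lemma square_summableP (f : X -> H) :
  reflect (summ (fun x => rnorm (f x) ^+ 2)) (f \in @square_summable X H).
Proof.
apply: (iffP (asboolP _)); rewrite /summable; congr (_ < _)%E.
  by apply: eq_esum => x _ /=; rewrite ger0_norm ?sqr_ge0.
by apply: eq_esum => x _ /=; rewrite ger0_norm ?sqr_ge0.
Qed.

Lemma square_summable_submod_closed : submod_closed (@square_summable X H).
Proof.
split.
  apply/square_summableP; rewrite /summable esum1// => x _.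
  by rewrite /= rnorm0 expr0n normr0.
move=> a f g /square_summableP sf /square_summableP sg; apply/square_summableP.
apply: (@le_summ _ _ _ (fun x => 2 * (complex.Re `|a| ^+ 2 * rnorm (f x) ^+ 2
                                     + rnorm (g x) ^+ 2))).
  move=> x; rewrite ger0_norm ?sqr_ge0// -exprMn -rnormZ; exact: rnormD_sqr.
by apply: summZ; apply: summD => //; exact: summZ.
Qed.

HB.instance Definition _ := GRing.isSubmodClosed.Build R[i] (X -> H)
  (@square_summable X H) square_summable_submod_closed.
HB.instance Definition _ := [SubChoice_isSubLmodule of l2 X H by <:].

Lemma l2_summ (f : l2 X H) : summ (fun x => rnorm (f x) ^+ 2).
Proof. exact/square_summableP/l2_fun_proof. Qed.

Definition l2_inner (f g : l2 X H) : R[i] := csum (fun x => inner (f x) (g x)).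

Lemma summ_Re_inner (f g : l2 X H) :
  summ (fun x => complex.Re (inner (f x) (g x))).
Proof.
apply: le_summ (summD (l2_summ f) (l2_summ g)) => x; exact: Re_inner_le.
Qed.

Lemma summ_Im_inner (f g : l2 X H) :
  summ (fun x => complex.Im (inner (f x) (g x))).
Proof.
apply: le_summ (summD (l2_summ f) (l2_summ g)) => x; exact: Im_inner_le.
Qed.

Let l2_innerC (f g : l2 X H) : l2_inner f g = conjC (l2_inner g f).
Proof.
rewrite /l2_inner -[RHS]csumJ; last exact: summ_Im_inner.
by congr csum; apply/funext => x; rewrite hermC expr0 mul1r.
Qed.

Let l2_innerl (g : l2 X H) : linear_for *%R (l2_inner^~ g).
Proof.
move=> a f f'; rewrite /l2_inner -csumZD;
  [|exact: summ_Re_inner|exact: summ_Im_inner|exact: summ_Re_inner|exact: summ_Im_inner].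
by congr csum; apply/funext => x; rewrite /= linearDl linearZl_LR.
Qed.

Let l2_innerr (f : l2 X H) : linear_for (conjC \; *%R) (l2_inner f).
Proof.
move=> a g g'; rewrite l2_innerC l2_innerl rmorphD rmorphM/= -!l2_innerC//.
Qed.

Let l2_inner_bilinear : bilinear_for *%R (conjC \; *%R) l2_inner.
Proof. by split; [exact: l2_innerl|exact: l2_innerr]. Qed.

HB.instance Definition _ := bilinear_isBilinear.Build R[i] (l2 X H) (l2 X H)
  R[i] *%R (conjC \; *%R) l2_inner l2_inner_bilinear.

Let l2_inner_herm (f g : l2 X H) :
  l2_inner f g = (-1) ^+ false * conjC (l2_inner g f).
Proof. by rewrite expr0 mul1r l2_innerC. Qed.

HB.instance Definition _ := isHermitianSesquilinear.Build R[i] (l2 X H) false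
  conjC l2_inner l2_inner_herm.

Let l2_inner_self (f : l2 X H) : l2_inner f f =
  (fine (\esum_(x in [set: X]) (rnorm (f x) ^+ 2)%:E))%:C%C.
Proof.
rewrite /l2_inner.
rewrite (_ : (fun x => _) = fun x => (rnorm (f x) ^+ 2)%:C%C); last first.
  by apply/funext => x; rewrite inner_rnorm.
congr Complex; rewrite rsum_ge0//.
- by move=> x; exact: sqr_ge0.
- exact: l2_summ.
- by rewrite esum1.
- by rewrite /summable esum1// => x _; rewrite /= normr0.
Qed.

Let l2_inner_gt0 (f : l2 X H) : f != 0 -> 0 < l2_inner f f.
Proof.
move=> f0; rewrite l2_inner_self (ltcR 0).
have fin := fin_esum (l2_summ f) (fun x => sqr_ge0 (rnorm (f x))).
have [x fx0] : exists x, f x != 0.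
  apply/not_existsP => f00; move/negP: f0; apply; apply/eqP/val_inj/funext => x.
  by apply/eqP; move/negP: (f00 x); rewrite negbK.
rewrite -lte_fin fineK//.
apply: (@lt_le_trans _ _ (rnorm (f x) ^+ 2)%:E).
  rewrite lte_fin exprn_gt0// lt_neqAle rnorm_ge0 andbT eq_sym.
  by apply: contra fx0 => /eqP/rnorm_eq0 ->.
rewrite -(@esum_set1 _ _ x (fun x => (rnorm (f x) ^+ 2)%:E)) ?lee_fin ?sqr_ge0//.
rewrite esum_mkcond; apply: le_esum => y _ /=.
by case: ifPn => _; rewrite lee_fin ?sqr_ge0.
Qed.

HB.instance Definition _ := isDotProduct.Build R[i] (l2 X H) l2_inner
  l2_inner_gt0.

HB.instance Definition _ :=
  Lmodule_isInner.Build R (l2 X H) (l2_inner : {dot l2 X H for conjC}).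

Lemma l2_rnorm (f : l2 X H) :
  rnorm f ^+ 2 = fine (\esum_(x in [set: X]) (rnorm (f x) ^+ 2)%:E).
Proof. by apply: complexI; rewrite -inner_rnorm -l2_inner_self. Qed.

Let delta_proof (y : X) (v : H) :
  (fun x => if x == y then v else 0) \in @square_summable X H.
Proof.
apply/square_summableP; rewrite /summable.
rewrite (@eq_esum _ _ _ _ (fun x => if x \in [set y] then (rnorm v ^+ 2)%:E else 0%E)).
  by rewrite -esum_mkcond esum_set1 ?lee_fin ?sqr_ge0 ?ltry.
move=> x _ /=; rewrite ger0_norm ?sqr_ge0//; have [->|/eqP xy] := eqVneq x y.
  by rewrite mem_set.
by rewrite memNset// rnorm0 expr0n.
Qed.

Definition l2_delta (y : X) (v : H) : l2 X H := L2 (delta_proof y v).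

End l2.

Section operators.
Context {R : realType}.

Definition bounded_operator (U : innerType R) (T : U -> U) :=
  linear T /\ exists M : R, forall u, rnorm (T u) <= M * rnorm u.

Definition is_adjoint (U : innerType R) (S T : U -> U) :=
  forall u v, inner (S u) v = inner u (T v).

Definition compact_operator (U : innerType R) (T : U -> U) :=
  bounded_operator T /\ precompact (T @` [set u | `|u| <= 1]).

(* The dimension of the range is at most N: repetitions and zeros are allowed
   among the e i. *)
Definition rank_le (U : innerType R) (N : nat) (T : U -> U) :=
  exists e : 'I_N -> U,
    range T = [set u | exists c : 'I_N -> R[i], u = \sum_(i < N) c i *: e i].

Record star_subalgebra (U : innerType R) (A : set (U -> U)) : Prop := {
  star_subalgebra_bounded : forall T, A T -> bounded_operator T ;
  star_subalgebra0 : A 0 ;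
  star_subalgebraD : forall S T, A S -> A T -> A (S + T) ;
  star_subalgebraZ : forall (a : R[i]) T, A T -> A (a *: T) ;
  star_subalgebraM : forall S T, A S -> A T -> A (S \o T) ;
  star_subalgebra_adj : forall T, A T -> exists2 T', A T' & is_adjoint T T' }.

(* Only the restriction of phi to A matters. *)
Record star_isomorphism (U V : innerType R) (A : set (U -> U))
    (B : set (V -> V)) (phi : (U -> U) -> (V -> V)) : Prop := {
  star_isomorphism_bij : set_bij A B phi ;
  star_isomorphismD : forall S T, A S -> A T -> phi (S + T) = phi S + phi T ;
  star_isomorphismZ : forall (a : R[i]) T, A T -> phi (a *: T) = a *: phi T ;
  star_isomorphismM : forall S T, A S -> A T -> phi (S \o T) = phi S \o phi T ;
  star_isomorphism_adj : forall T T', A T -> A T' -> is_adjoint T T' ->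
    is_adjoint (phi T) (phi T') }.

Lemma is_adjoint_unique (U : innerType R) (S T T' : U -> U) :
  is_adjoint S T -> is_adjoint S T' -> T = T'.
Proof.
move=> ST ST'; apply/funext => v; apply/eqP; rewrite -subr_eq0.
set w := T v - T' v; rewrite -(dnorm_eq0 inner); apply/eqP.
transitivity (inner w (T v) - inner w (T' v)); first exact: linearBr.
by rewrite -ST -ST' subrr.
Qed.

End operators.

Section coarse.
Context {R : realType}.

Definition bounded_geometry (X : metricType R) :=
  forall r : R, 0 <= r -> exists N : nat,
    forall x : X, ([set y | mdist x y <= r] #<= `I_N)%card.

Definition uniformly_expansive (X Y : metricType R) (f : X -> Y) :=
  forall r : R, 0 < r -> exists2 s : R, 0 < s &
    forall x1 x2, mdist x1 x2 <= r -> mdist (f x1) (f x2) <= s.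

Definition close_maps (X Y : metricType R) (f g : X -> Y) :=
  exists2 c : R, 0 < c & forall x, mdist (f x) (g x) <= c.

Definition coarsely_equivalent (X Y : metricType R) :=
  exists (f : X -> Y) (g : Y -> X),
    [/\ uniformly_expansive f, uniformly_expansive g,
        close_maps (f \o g) id & close_maps (g \o f) id].

End coarse.

Section roe.
Context {R : realType} {X : metricType R} {H : innerType R}.
Implicit Type T : l2 X H -> l2 X H.

Definition matrix_coef T (x y : X) : H -> H := fun v => T (l2_delta y v) x.

Definition finite_propagation T :=
  exists2 s : R, 0 < s &
    forall x y : X, s <= mdist x y -> matrix_coef T x y = 0.

Definition locally_compact_operator T :=
  forall x y : X, compact_operator (matrix_coef T x y).

Record roe_type_algebra (A : set (l2 X H -> l2 X H)) : Prop := {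
  roe_star_subalgebra : star_subalgebra A ;
  roe_locally_compact : forall T, A T -> locally_compact_operator T ;
  roe_finite_propagation : forall T, A T -> finite_propagation T ;
  roe_finite_rank : forall T, bounded_operator T -> finite_propagation T ->
    (exists N : nat, forall x y : X, rank_le N (matrix_coef T x y)) -> A T }.

End roe.

Definition separable_space (T : topologicalType) :=
  exists2 D : set T, countable D & dense D.

(* Main.v *)
Require Import Defs.
From mathcomp Require Import all_boot all_order all_algebra complex.
From mathcomp Require Import boolp classical_sets functions cardinality.
From mathcomp Require Import fsbigop reals ereal topology normedtype numfun esum.
From mathcomp Require Import sequences lra.

Set Implicit Arguments.
Unset Strict Implicit.
Unset Printing Implicit Defensive.

Import Order.TTheory GRing.Theory Num.Theory Num.Def.
Import numFieldTopology.Exports numFieldNormedType.Exports.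

Local Open Scope classical_set_scope.
Local Open Scope ring_scope.

(** A star-isomorphism phi of algebraic Roe-type algebras is spatial. If p is
    the projection onto a unit vector u0 supported at a single point, then
    phi p is a nonzero projection; pick a unit vector w of bounded support in
    its range. Then U u := phi (dyad u u0) w, where dyad a b is the rank one
    operator v |-> <v,b> a, is an isometry from the vectors of bounded support
    over X onto those over Y. It intertwines T and phi T, because
    T (dyad u u0) = dyad (T u) u0. Let V be the inverse of U
    ([exists_spatial_implementation]).

    A vector supported at x may spread out under U, but only boundedly, and
    uniformly so ([uniform_propagation]): for every r there is s such that
    U (delta_x h) and U (delta_x' h') have supports within s of one another
    whenever d(x,x') <= r, whatever h and h' are. The proof is a gliding hump.
    If it fails, there are unit vectors h_n, h'_n, points x_n, x'_n with
    d(x_n,x'_n) <= r, and points y_n, y'_n in the two supports with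
    d(y_n,y'_n) > n. After passing to a sparse subsequence, the x_n are
    distinct, the x'_n are distinct, and T := sum_n dyad (delta_{x_n} h_n)
    (delta_{x'_n} h'_n) is a bounded operator of propagation at most r with
    matrix coefficients of rank at most one, so it lies in the algebra over X.
    Its image has infinite propagation, since for each n some matrix entry of
    phi T between y_n and y'_n comes from the n-th term alone. That is absurd.

    Sparse subsequences exist because U maps all vectors supported at a point of
    a given ball into one common ball ([ball_image_bounded]). For the
    vectors at a single point x this is a Baire category argument in H
    ([point_image_bounded], [avoid_hyperplanes]), which is what makes it
    uniform in h when H has infinite dimension; bounded geometry passes from
    points to balls.

    Finally choose f x in the support of U (delta_x h) and g y in the support
    of V (delta_y k), for fixed nonzero h and k. Uniform propagation of U and V
    makes f and g uniformly expansive. It also makes them mutually inverse up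
    to a bounded error: y lies in the support of U (delta_x h') for some h' as
    soon as x lies in the support of V (delta_y k). *)

(** * Rank one operators on an inner product space *)

Section inner_space.
Context {R : realType} {U : innerType R}.
Implicit Types (u v a b : U).

Lemma inner0l u : inner 0 u = 0 :> R[i]. Proof. exact: linear0l. Qed.
Lemma inner0r u : inner u 0 = 0 :> R[i]. Proof. exact: linear0r. Qed.
Lemma innerDl u v w : inner (u + v) w = inner u w + inner v w :> R[i].
Proof. exact: linearDl. Qed.
Lemma innerZl (c : R[i]) u v : inner (c *: u) v = c * inner u v :> R[i].
Proof. exact: linearZl_LR. Qed.
Lemma innerZr (c : R[i]) u v : inner u (c *: v) = c^* * inner u v :> R[i].
Proof. exact: linearZr_LR. Qed.
Lemma innerC u v : inner u v = (inner v u)^* :> R[i].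
Proof. by rewrite hermC expr0 mul1r. Qed.
Lemma inner_eq0 u : (inner u u == 0 :> R[i]) = (u == 0).
Proof. exact: dnorm_eq0. Qed.

Lemma eq_inner u v : (forall w, inner u w = inner v w :> R[i]) -> u = v.
Proof.
move=> uv; apply/eqP; rewrite -subr_eq0 -inner_eq0 innerDl uv -innerDl.
by rewrite subrr inner0l.
Qed.

Lemma rnorm_gt0 u : (0 < rnorm u) = (u != 0).
Proof.
rewrite lt_neqAle rnorm_ge0 andbT eq_sym; congr negb.
by apply/eqP/eqP => [/rnorm_eq0//|->]; rewrite rnorm0.
Qed.

Lemma norm_inner_le u v : complex.Re `|inner u v| <= rnorm u * rnorm v.
Proof.
rewrite -lecR RRe_real ?normr_real// rmorphM/= !rnormE.
by have := dot_CauchySchwarz inner u v; rewrite !inner_norm !sqrCK.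
Qed.

Lemma exists_unit : (exists u : U, u != 0) -> exists u, rnorm u = 1.
Proof.
case=> u u0; exists ((rnorm u)^-1%:C%C *: u).
rewrite rnormZ ger0_norm ?ler0c ?invr_ge0 ?rnorm_ge0//= mulVf//.
by rewrite gt_eqF ?rnorm_gt0.
Qed.

Definition dyad a b : U -> U := fun v => inner v b *: a.

Lemma dyad_linear a b : linear (dyad a b).
Proof. by move=> c u v; rewrite /dyad innerDl innerZl scalerDl scalerA. Qed.

Lemma dyad_rnorm a b v : rnorm (dyad a b v) <= rnorm v * rnorm b * rnorm a.
Proof.
by rewrite /dyad rnormZ ler_wpM2r ?rnorm_ge0// norm_inner_le.
Qed.

Lemma dyad_bounded a b : bounded_operator (dyad a b).
Proof.
split; first exact: dyad_linear.
exists (rnorm b * rnorm a) => v.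
by rewrite mulrC mulrA dyad_rnorm.
Qed.

Lemma dyad_adjoint a b : is_adjoint (dyad a b) (dyad b a).
Proof.
by move=> u v; rewrite /dyad innerZl innerZr -innerC mulrC.
Qed.

Lemma dyad_comp a b c d : dyad a b \o dyad c d = inner c b *: dyad a d.
Proof.
apply/funext => v.
by rewrite /dyad/= innerZl mulrC -scalerA.
Qed.

Lemma linear_fun0 (T : U -> U) : linear T -> T 0 = 0.
Proof.
move=> lT; apply: (@addrI _ (T 0)).
by rewrite -{1}(scale1r (T 0)) -lT scale1r !addr0.
Qed.

Lemma linear_funZ (T : U -> U) c u : linear T -> T (c *: u) = c *: T u.
Proof. by move=> lT; rewrite -[c *: u]addr0 lT (linear_fun0 lT) addr0. Qed.

Lemma comp_dyad (T : U -> U) a b : linear T -> T \o dyad a b = dyad (T a) b.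
Proof.
by move=> lT; apply/funext => v; rewrite /dyad /= (linear_funZ _ _ lT).
Qed.

Lemma dyad_rank a b : rank_le 1 (dyad a b).
Proof.
have [->|b0] := eqVneq b 0.
  exists (fun=> 0); apply/seteqP; split => u /=.
    case=> v _ <-; exists (fun=> 0).
    by rewrite big_ord1 scaler0 /dyad inner0r scale0r.
  case=> c ->; exists 0 => //.
  by rewrite big_ord1 scaler0 /dyad inner0r scale0r.
exists (fun=> a); apply/seteqP; split => u /=.
  by case=> v _ <-; exists (fun=> inner v b); rewrite big_ord1.
case=> c ->; exists ((c ord0 / inner b b) *: b) => //.
by rewrite big_ord1 /dyad innerZl divfK// inner_eq0.
Qed.

End inner_space.

(** * Countably many hyperplanes do not cover a Hilbert space *)

Section hyperplanes.
Context {R : realType} {H : hilbertType R}.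

(** Moving h by at most r/2 along w leaves the hyperplane orthogonal to w; by
    Cauchy-Schwarz, a small ball around the new point still avoids it. *)
Let shrink_step (w h : H) (r : R) : w != 0 -> 0 < r ->
  exists h' r', [/\ 0 < r', r' <= r / 2, rnorm (h' - h) <= r / 2 &
    forall z, rnorm (z - h') <= r' -> inner z w != 0].
Proof.
move=> w0 r0; have nw : 0 < rnorm w by rewrite rnorm_gt0.
have [h' h'h h'w] : exists2 h' : H, rnorm (h' - h) <= r / 2 & inner h' w != 0.
  have [hw|hw] := eqVneq (inner h w) 0; last first.
    by exists h => //; rewrite subrr rnorm0 divr_ge0// ltW.
  have t0 : 0 < r / 2 / rnorm w by rewrite !divr_gt0.
  exists (h + (r / 2 / rnorm w)%:C%C *: w).
    rewrite addrAC subrr add0r rnormZ ger0_norm ?ler0c ?(ltW t0)//=.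
    by rewrite divfK// gt_eqF.
  by rewrite innerDl hw add0r innerZl mulf_neq0 ?inner_eq0// fmorph_eq0 gt_eqF.
set c := complex.Re `|inner h' w|.
have c0 : 0 < c by rewrite -ltcR RRe_real ?normr_real// normr_gt0.
exists h', (Num.min (r / 2) (c / 2 / rnorm w)); split => //.
- by rewrite lt_min !divr_gt0.
- by rewrite ge_min lexx.
move=> z; rewrite le_min => /andP[_ zh']; apply/eqP => zw.
have : c <= rnorm (z - h') * rnorm w.
  apply: le_trans (norm_inner_le _ _).
  by rewrite innerDl zw add0r -scaleN1r innerZl mulN1r normrN.
rewrite leNgt => /negP; apply; rewrite (@le_lt_trans _ _ (c / 2))//.
  by rewrite -ler_pdivlMr.
by rewrite ltr_pdivrMr// ltr_pMr// ltr1n.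
Qed.

(** The Baire category theorem for the hyperplanes orthogonal to the w n, by
    nested balls: the n-th ball avoids the hyperplane of w n, radii are at
    least halved, and the limit of the centres lies in every ball. *)
Lemma avoid_hyperplanes (w : nat -> H) : (forall n, w n != 0) ->
  exists h, forall n, inner h (w n) != 0.
Proof.
move=> w0.
pose P (n : nat) (p q : H * R) := 0 < p.2 -> [/\ 0 < q.2, q.2 <= p.2 / 2,
  rnorm (q.1 - p.1) <= p.2 / 2 &
  forall z, rnorm (z - q.1) <= q.2 -> inner z (w n) != 0].
have [F FP] : {F : nat * (H * R) -> H * R & forall np, P np.1 np.2 (F np)}.
  apply: (@choice _ _ (fun np => P np.1 np.2)) => -[n [h r]]; rewrite /P/=.
  have [r0|r0] := ltP 0 r; last by exists (0, 0).
  by have [h' [r' ?]] := shrink_step h (w0 n) r0; exists (h', r').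
pose s := fix s n := if n is n'.+1 then F (n', s n') else (0 : H, 1 : R).
have s0 n : 0 < (s n).2.
  by elim: n => //= n IH; have [] := FP (n, s n) IH.
have sS n : P n (s n) (s n.+1) := FP (n, s n).
have sle n : (s n).2 <= 2^-1 ^+ n.
  elim: n => [|n IH]; first by rewrite expr0.
  have [_ h _ _] := sS n (s0 n); apply: (le_trans h).
  by rewrite exprSr ler_wpM2r// invr_ge0.
(* Halving the radii makes the distance between centres telescope. *)
have near n k : rnorm ((s (n + k)%N).1 - (s n).1) <= (s n).2 - (s (n + k)%N).2.
  elim: k => [|k IH]; first by rewrite addn0 !subrr rnorm0.
  rewrite addnS; have [_ h1 h2 _] := sS (n + k)%N (s0 _).
  have -> : (s (n + k).+1).1 - (s n).1 =
      ((s (n + k).+1).1 - (s (n + k)%N).1) + ((s (n + k)%N).1 - (s n).1).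
    by rewrite addrA subrK.
  apply: (le_trans (le_rnormD _ _)); move: IH h1 h2.
  move: (rnorm _) (rnorm _) (s n).2 (s _).2 (s _).2 => *; lra.
have nearW n m : (n <= m)%N -> rnorm ((s m).1 - (s n).1) <= (s n).2.
  move=> nm; have := near n (m - n)%N; rewrite subnKC// => h.
  by rewrite (le_trans h)// gerBl ltW.
have cv : cvg ((fun n => (s n).1) @ \oo).
  suff : cauchy ((fun n => (s n).1) @ \oo) by exact: cauchy_cvg.
  suff : cauchy_ex ((fun n => (s n).1) @ \oo) by exact: cauchy_exP.
  move=> e e0.
  have eR : e = (complex.Re e)%:C%C by rewrite RRe_real// gtr0_real.
  have Re0 : 0 < complex.Re e by rewrite -ltcR -eR.
  have : (fun n => 2^-1 ^+ n : R) @ \oo --> (0 : R).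
    by apply: cvg_expr; rewrite ger0_norm ?invr_ge0// invf_lt1 ?ltr1n.
  move=> /cvgrPdist_lt/(_ _ Re0)[N _ /(_ N (leqnn N))] /=.
  rewrite sub0r normrN ger0_norm ?exprn_ge0 ?invr_ge0// => Ne.
  exists (s N).1, N => // m /= Nm.
  rewrite -ball_normE /= distrC eR -rnormE ltcR.
  exact: le_lt_trans (le_trans (nearW _ _ Nm) (sle N)) Ne.
have [h hl] : exists h, forall n, rnorm (h - (s n).1) <= (s n).2.
  exists (lim ((fun n => (s n).1) @ \oo)) => n; apply/ler_addgt0Pl => e e0.
  have eC : 0 < e%:C%C by rewrite ltcR.
  have [N _ NP] := (cvgrPdist_lt _ _).1 cv _ eC.
  have := NP (maxn N n) (leq_maxl _ _); rewrite /= -rnormE ltcR => h1.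
  have h2 := nearW n (maxn N n) (leq_maxr _ _).
  set l := lim _ in h1 *.
  have -> : l - (s n).1 = (l - (s (maxn N n)).1) + ((s (maxn N n)).1 - (s n).1).
    by rewrite addrA subrK.
  by rewrite (le_trans (le_rnormD _ _))// lerD// ltW.
exists h => n; have [_ _ _] := sS n (s0 n); apply; exact: hl.
Qed.
End hyperplanes.

(** * Square summable functions and their coordinates *)

Section l2_coordinates.
Context {R : realType} {X : choiceType} {H : innerType R}.
Implicit Types (f g : l2 X H) (x y z : X) (v : H).

Lemma l2_ext f g : (forall x, f x = g x) -> f = g.
Proof. by move=> fg; apply/val_inj/funext. Qed.

Lemma l2_neq0 f : f != 0 -> exists x, f x != 0.
Proof.
move=> f0; apply/not_existsP => f00; move/negP: f0; apply.
apply/eqP/l2_ext => x.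
by apply/eqP; move/negP: (f00 x); rewrite negbK.
Qed.

Lemma l2_deltaE y v x : l2_delta y v x = if x == y then v else 0.
Proof. by []. Qed.

Let rsum_single (u : X -> R) x : (forall z, z != x -> u z = 0) -> rsum u = u x.
Proof.
move=> u0; have single (w : X -> \bar R) : (forall z, 0 <= w z)%E ->
    (forall z, z != x -> w z = 0%E) -> esum setT w = w x.
  move=> w0 wx; rewrite -(@esum_set1 _ _ x w)// [RHS]esum_mkcond.
  apply: eq_esum => z _; have [->|zx] := eqVneq z x; first by rewrite mem_set.
  by rewrite memNset ?wx// => /eqP; apply/negP.
have u0E z : z != x -> (EFin \o u) z = 0%E by move=> zx; rewrite /= u0.
rewrite /rsum !single.
- rewrite funeposE funenegE /= -!EFin_max -EFinB /=.
  have [h|h] := leP 0 (u x); first by rewrite max_r ?oppr_le0// subr0.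
  by rewrite max_l ?oppr_ge0 ?ltW// sub0r opprK.
- exact: funeneg_ge0.
- by move=> z zx; rewrite funenegE u0E// oppe0 maxxx.
- exact: funepos_ge0.
- by move=> z zx; rewrite funeposE u0E// maxxx.
Qed.

Lemma inner_l2_single f g x :
  (forall z, z != x -> inner (f z) (g z) = 0 :> R[i]) ->
  inner f g = inner (f x) (g x) :> R[i].
Proof.
move=> fg0; rewrite -[LHS]/(csum (fun z => inner (f z) (g z))) /csum.
rewrite !(@rsum_single _ x) => [|z zx|z zx]; [|by rewrite fg0..].
by case: (inner (f x) (g x)).
Qed.

Lemma inner_l2_neq0 f g : inner f g != 0 :> R[i] ->
  exists x, inner (f x) (g x) != 0 :> R[i].
Proof.
move=> fg; apply: contrapT => /forallNP fg0; move/negP: (fg); apply.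
have {}fg0 z : inner (f z) (g z) = 0 :> R[i].
  by apply/eqP; move/negP: (fg0 z); rewrite negbK.
have [f0|/l2_neq0[x _]] := eqVneq f 0; first by rewrite f0 inner0l.
by rewrite (@inner_l2_single f g x)// fg0.
Qed.

Lemma inner_deltar f x v : inner f (l2_delta x v) = inner (f x) v :> R[i].
Proof.
rewrite (@inner_l2_single _ _ x) ?l2_deltaE ?eqxx// => z zx.
by rewrite l2_deltaE (negbTE zx) inner0r.
Qed.

Lemma inner_deltal f x v : inner (l2_delta x v) f = inner v (f x) :> R[i].
Proof. by rewrite innerC inner_deltar -innerC. Qed.

Lemma l2_delta_neq0 x v : v != 0 -> l2_delta x v != 0 :> l2 X H.
Proof.
by move=> v0; rewrite -inner_eq0 inner_deltar l2_deltaE eqxx inner_eq0.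
Qed.

End l2_coordinates.

(** * Weighted partial translations *)

Section weighted_translation.
Context {R : realType} {X : choiceType} {H : innerType R}.
Variables (s : X -> X) (a b : X -> H).
Hypothesis s_inj : forall x y, a x != 0 -> a y != 0 -> s x = s y -> x = y.
Hypothesis a_le1 : forall x, rnorm (a x) <= 1.
Hypothesis b_le1 : forall x, rnorm (b x) <= 1.

Let wt_fun (v : X -> H) x : H := inner (v (s x)) (b x) *: a x.

Let wt_le (v : l2 X H) : (\esum_(x in [set: X]) (rnorm (wt_fun v x) ^+ 2)%:E <=
  \esum_(x in [set: X]) (rnorm (v x) ^+ 2)%:E)%E.
Proof.
pose D := [set x | a x != 0].
have sD : set_inj D s.
  by move=> x y /set_mem xD /set_mem yD; exact: s_inj.
apply: (@le_trans _ _ (\esum_(x in s @` D) (rnorm (v x) ^+ 2)%:E)%E).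
  rewrite (esum_image _ _ _ sD) [leRHS]esum_mkcond; apply: le_esum => x _.
  case: ifPn => [_|/negP xD].
    rewrite lee_fin lerXn2r ?nnegrE ?rnorm_ge0//.
    rewrite (le_trans (dyad_rnorm _ _ _))// -mulrA ler_piMr ?rnorm_ge0//.
    by rewrite mulr_ile1 ?rnorm_ge0.
  have ax : a x = 0 by apply/eqP; apply: contra_notT xD => ax; rewrite inE.
  by rewrite /wt_fun ax scaler0 rnorm0 expr0n.
rewrite esum_mkcond; apply: le_esum => x _.
by case: ifPn => _; rewrite lee_fin ?sqr_ge0.
Qed.

Let wt_l2 (v : l2 X H) : wt_fun v \in @square_summable R X H.
Proof.
apply/asboolP; apply: le_lt_trans (wt_le v) _.
exact/asboolP/l2_fun_proof.
Qed.

(** The operator sum_x dyad (delta_x (a x)) (delta_(s x) (b x)). Injectivity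
    of s on the support of a makes distinct terms act between orthogonal lines,
    hence boundedness. *)
Definition weighted_translation (v : l2 X H) : l2 X H := L2 (wt_l2 v).

Lemma weighted_translationE v x :
  weighted_translation v x = inner (v (s x)) (b x) *: a x.
Proof. by []. Qed.

Lemma weighted_translation_bounded : bounded_operator weighted_translation.
Proof.
split=> [c u v|].
  apply: l2_ext => x.
  rewrite -[RHS]/(c *: weighted_translation u x + weighted_translation v x).
  rewrite !weighted_translationE -[(c *: u + v) (s x)]/(c *: u (s x) + v (s x)).
  by rewrite innerDl innerZl scalerDl scalerA.
exists 1 => v; rewrite mul1r -(@ler_pXn2r _ 2) ?nnegrE ?rnorm_ge0//.
rewrite !l2_rnorm fine_le//; last exact: wt_le.
  by apply: fin_esum (l2_summ _) _ => x; exact: sqr_ge0.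
by apply: fin_esum (l2_summ _) _ => x; exact: sqr_ge0.
Qed.

End weighted_translation.

(** * Roe-type algebras and vectors of bounded support *)

Section roe_algebra.
Context {R : realType} {X : metricType R} {H : innerType R}.
Implicit Types (u v : l2 X H) (x y : X).

Definition bounded_support v :=
  exists x r, forall y, v y != 0 -> mdist x y <= r.

Lemma bounded_support_radius v x : bounded_support v ->
  exists r, forall y, v y != 0 -> mdist x y <= r.
Proof.
case=> z [r vr]; exists (mdist x z + r) => y /vr zy.
by rewrite (le_trans (metric_triangle _ z _))// lerD2l.
Qed.

Lemma l2_delta_bounded_support x h : bounded_support (l2_delta x h : l2 X H).
Proof.
exists x, 0 => y; rewrite l2_deltaE.
by have [->|] := eqVneq y x; rewrite ?mdistxx ?eqxx.
Qed.

Lemma dyad_coef u v x y : matrix_coef (dyad u v) x y = dyad (u x) (v y).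
Proof.
apply/funext => h; rewrite /matrix_coef.
rewrite -[LHS]/(inner (l2_delta y h) v *: u x).
by rewrite inner_deltal.
Qed.

Lemma weighted_translation_coef (s : X -> X) (a b : X -> H)
    (sI : forall x y, a x != 0 -> a y != 0 -> s x = s y -> x = y)
    (a1 : forall x, rnorm (a x) <= 1) (b1 : forall x, rnorm (b x) <= 1) x y :
  matrix_coef (weighted_translation sI a1 b1) x y =
  dyad (a x) (if s x == y then b x else 0).
Proof.
apply/funext => v; rewrite /matrix_coef weighted_translationE l2_deltaE /dyad.
by case: eqP; rewrite ?inner0l ?inner0r.
Qed.

Variable A : set (l2 X H -> l2 X H).
Hypothesis rA : roe_type_algebra A.

Lemma roe_dyad u v : bounded_support u -> bounded_support v -> A (dyad u v).
Proof.
move=> bu bv; apply: (roe_finite_rank rA).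
- exact: dyad_bounded.
- case: bu => x [r ur]; have [t vt] := bounded_support_radius x bv.
  exists (`|r| + `|t| + 1) => [|y z yz].
    by rewrite ltr_wpDl// addr_ge0.
  rewrite dyad_coef; apply/funext => h; rewrite /dyad.
  have [->|/ur xy] := eqVneq (u y) 0; first by rewrite scaler0.
  have [->|/vt xz] := eqVneq (v z) 0; first by rewrite inner0r scale0r.
  have : `|r| + `|t| + 1 <= r + t.
    rewrite (le_trans yz)// (le_trans (metric_triangle _ x _))// lerD//.
    by rewrite metric_sym.
  by have := ler_norm r; have := ler_norm t; move=> *; exfalso; lra.
- by exists 1%N => x y; rewrite dyad_coef; exact: dyad_rank.
Qed.

Lemma roe_weighted_translation (s : X -> X) (a b : X -> H)
    (sI : forall x y, a x != 0 -> a y != 0 -> s x = s y -> x = y)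
    (a1 : forall x, rnorm (a x) <= 1) (b1 : forall x, rnorm (b x) <= 1) r :
  (forall x, a x != 0 -> mdist x (s x) <= r) ->
  A (weighted_translation sI a1 b1).
Proof.
move=> sr; apply: (roe_finite_rank rA).
- exact: weighted_translation_bounded.
- exists (`|r| + 1) => [|x y xy]; first by rewrite ltr_wpDl.
  rewrite weighted_translation_coef; apply/funext => h; rewrite /dyad.
  have [->|/sr xs] := eqVneq (a x) 0; first by rewrite scaler0.
  case: eqP => [sy|_]; last by rewrite inner0r scale0r.
  have : `|r| + 1 <= r by rewrite -sy in xy; exact: le_trans xy xs.
  by have := ler_norm r; move=> *; exfalso; lra.
- exists 1%N => x y; rewrite weighted_translation_coef; exact: dyad_rank.
Qed.

Lemma roe_bounded T : A T -> bounded_operator T.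
Proof. exact: star_subalgebra_bounded (roe_star_subalgebra rA) _. Qed.

Lemma roe_linear T : A T -> linear T.
Proof. by case/roe_bounded. Qed.

(** The coordinates of T v are read off by pairing v with the images of point
    masses under the adjoint of T, which spread by at most the propagation of
    that adjoint. *)
Lemma roe_bounded_support T v : A T -> bounded_support v ->
  bounded_support (T v).
Proof.
move=> AT [x [r vr]].
have [T' AT' TT'] := star_subalgebra_adj (roe_star_subalgebra rA) AT.
have [s s0 sT'] := roe_finite_propagation rA AT'.
exists x, (r + s) => y Tvy.
have : inner (T v) (l2_delta y (T v y)) != 0 by rewrite inner_deltar inner_eq0.
rewrite TT' => /inner_l2_neq0[z vz].
have /vr xz : v z != 0 by apply: contraNneq vz => ->; rewrite inner0l.
have zy : mdist z y <= s.
  rewrite leNgt; apply/negP => /ltW /sT' T'0.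
  by move: vz; rewrite -[T' _ z]/(matrix_coef T' z y (T v y)) T'0 inner0r eqxx.
by rewrite (le_trans (metric_triangle _ z _))// lerD.
Qed.

(** Vanishing on point masses kills the matrix coefficients of T, hence those of
    its adjoint T'; the adjoint then kills point masses, which says that every
    coordinate of every T v is zero. *)
Lemma roe_eq0 T : A T -> (forall v, bounded_support v -> T v = 0) -> T = 0.
Proof.
move=> AT T0.
have [T' AT' TT'] := star_subalgebra_adj (roe_star_subalgebra rA) AT.
have T'0 x h : T' (l2_delta x h) = 0.
  apply: l2_ext => y; apply: eq_inner => w; rewrite inner0l.
  rewrite -inner_deltar innerC -TT' T0 ?inner0l ?rmorph0//.
  exact: l2_delta_bounded_support.
apply/funext => v; apply: l2_ext => x; apply: eq_inner => w.
by rewrite inner0l -inner_deltar TT' T'0 inner0r.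
Qed.

End roe_algebra.

(** * Isomorphisms of Roe-type algebras are spatial *)

Section spatial.
Context {R : realType} {X Y : metricType R} {H K : innerType R}.
Variables (A : set (l2 X H -> l2 X H)) (B : set (l2 Y K -> l2 Y K)).

(** Meant for mutually inverse unitaries U and V between the vectors of bounded
    support, conjugation by which exchanges A and B. Everything is expressed by
    pairings: linearity and continuity in one argument then come from the inner
    product, and the two sides play symmetric roles. *)
Record spatial_implementation
    (U : l2 X H -> l2 Y K) (V : l2 Y K -> l2 X H) : Prop := {
  spatial_support : forall u, bounded_support u -> bounded_support (U u) ;
  spatial_support_inv : forall w, bounded_support w -> bounded_support (V w) ;
  spatial_inner : forall u w, bounded_support u -> bounded_support w ->
    inner (U u) w = inner u (V w) ;
  spatial_neq0 : forall u, bounded_support u -> u != 0 -> U u != 0 ;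
  spatial_neq0_inv : forall w, bounded_support w -> w != 0 -> V w != 0 ;
  spatial_image : forall T, A T -> exists2 S, B S & forall w w',
    bounded_support w -> bounded_support w' ->
    inner (S w) w' = inner (T (V w)) (V w') ;
  spatial_preimage : forall S, B S -> exists2 T, A T & forall u u',
    bounded_support u -> bounded_support u' ->
    inner (T u) u' = inner (S (U u)) (U u') }.

Variable phi : (l2 X H -> l2 X H) -> (l2 Y K -> l2 Y K).
Hypotheses (rA : roe_type_algebra A) (rB : roe_type_algebra B).
Hypothesis iphi : star_isomorphism A B phi.

Let phiAB T : A T -> B (phi T).
Proof. by have [] := star_isomorphism_bij iphi => + _ _; apply. Qed.

Let phi_surj S : B S -> exists2 T, A T & phi T = S.
Proof. by have [_ _] := star_isomorphism_bij iphi; apply. Qed.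

Lemma star_isomorphism0 : phi 0 = 0.
Proof.
have A0 := star_subalgebra0 (roe_star_subalgebra rA).
by have := star_isomorphismZ iphi 0 A0; rewrite !scale0r.
Qed.

Lemma star_isomorphism_eq0 T : A T -> phi T = 0 -> T = 0.
Proof.
move=> AT T0; have A0 := star_subalgebra0 (roe_star_subalgebra rA).
have [_ + _] := star_isomorphism_bij iphi; apply; rewrite ?inE//.
by rewrite T0 star_isomorphism0.
Qed.

(** The vector w below is fixed by the projection q = phi (dyad u0 u0). Since
    (dyad u0 v) (dyad u u0) = <u,v> dyad u0 u0 and w is a unit vector, the map
    U u = phi (dyad u u0) w is isometric. Its range is invariant under phi T
    for all T in A, that is under B, and contains w; as B contains dyad v w,
    every v of bounded support is reached. *)
Lemma exists_spatial_implementation (x : X) (h : H) : h != 0 ->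
  exists U V, spatial_implementation U V.
Proof.
move=> h0.
have [u0 bu0 u0u0] : exists2 u0 : l2 X H,
    bounded_support u0 & inner u0 u0 = 1 :> R[i].
  have [e e1] : exists e : H, rnorm e = 1 by apply: exists_unit; exists h.
  exists (l2_delta x e); first exact: l2_delta_bounded_support.
  by rewrite inner_deltar l2_deltaE eqxx inner_rnorm e1 expr1n.
pose q := phi (dyad u0 u0).
have Aq : A (dyad u0 u0) by exact: roe_dyad.
have qq w : q (q w) = q w.
  rewrite /q -[LHS]/((phi (dyad u0 u0) \o phi (dyad u0 u0)) w).
  by rewrite -(star_isomorphismM iphi)// dyad_comp u0u0 scale1r.
have [w [bw w1 qw]] : exists w, [/\ bounded_support w, rnorm w = 1 & q w = w].
  have [z bz qz] : exists2 z, bounded_support z & q z != 0.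
    apply: contrapT => nz.
    have q0 : q = 0.
      apply: (roe_eq0 rB (phiAB Aq)) => z bz; apply/eqP; apply: contra_notT nz.
      by exists z.
    have := congr1 (fun T => T u0) (star_isomorphism_eq0 Aq q0).
    rewrite /dyad u0u0 scale1r => u00.
    by move: u0u0; rewrite u00 inner0l => /esym/eqP; rewrite oner_eq0.
  pose c : R[i] := (rnorm (q z))^-1%:C%C.
  have lq : linear q := roe_linear rB (phiAB Aq).
  have bq := roe_bounded_support rB (phiAB Aq) bz.
  exists (c *: q z); split.
  - case: bq => y [r qr]; exists y, r => y'.
    rewrite -[(c *: q z) y']/(c *: (q z y')) scaler_eq0 negb_or => /andP[_].
    exact: qr.
  - rewrite rnormZ ger0_norm ?ler0c ?invr_ge0 ?rnorm_ge0//= mulVf//.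
    by rewrite gt_eqF ?rnorm_gt0.
  - by rewrite (linear_funZ _ _ lq) qq.
pose U u := phi (dyad u u0) w.
have bU u : bounded_support u -> bounded_support (U u).
  by move=> bu; exact: (roe_bounded_support rB (phiAB (roe_dyad rA bu bu0)) bw).
have UT T u : A T -> bounded_support u -> U (T u) = phi T (U u).
  move=> AT bu; have Au : A (dyad u u0) by exact: roe_dyad.
  rewrite /U -(comp_dyad _ _ (roe_linear rA AT)) (star_isomorphismM iphi)//.
have Uiso u v : bounded_support u -> bounded_support v ->
    inner (U u) (U v) = inner u v.
  move=> bu bv; rewrite /U.
  have adj : is_adjoint (phi (dyad u0 v)) (phi (dyad v u0)).
    apply: (star_isomorphism_adj iphi); [exact: roe_dyad..|exact: dyad_adjoint].
  rewrite -adj -[X in inner X w]/((phi (dyad u0 v) \o phi (dyad u u0)) w).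
  rewrite -(star_isomorphismM iphi) ?dyad_comp; [|exact: roe_dyad..].
  rewrite (star_isomorphismZ iphi) ?innerZl; last exact: roe_dyad.
  rewrite -[phi _ w]/(q w) qw.
  by rewrite inner_rnorm w1 expr1n mulr1.
have Usurj v : exists u, bounded_support v -> bounded_support u /\ U u = v.
  have [bv|] := pselect (bounded_support v); last by exists u0.
  have [T AT phiT] := phi_surj (roe_dyad rB bv bw).
  exists (T u0) => _; split; first exact: (roe_bounded_support rA).
  rewrite UT// phiT /dyad -[U u0]/(q w) qw inner_rnorm w1 expr1n.
  exact: scale1r.
have [V VP] := choice Usurj.
have bV v : bounded_support v -> bounded_support (V v) by move=> /VP[].
have UV v : bounded_support v -> U (V v) = v by move=> /VP[].
exists U, V; split => //.
- by move=> u v bu bv; rewrite -[in LHS](UV v)// Uiso//; exact: bV.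
- move=> u bu; apply: contraNneq => Uu.
  by rewrite -inner_eq0 -Uiso// Uu inner0l.
- move=> v bv; apply: contraNneq => Vv.
  have b0 : bounded_support (0 : l2 X H) by rewrite -Vv; exact: bV.
  by rewrite -(UV v bv) Vv -inner_eq0 Uiso ?inner0l.
- move=> T AT; exists (phi T) => [|v v' bv bv']; first exact: phiAB.
  rewrite -{1}(UV v)// -{1}(UV v')// -UT// ?Uiso//; try exact: bV.
  by apply: (roe_bounded_support rA) => //; exact: bV.
- move=> S BS; have [T AT <-] := phi_surj BS; exists T => // u u' bu bu'.
  by rewrite -UT// Uiso//; exact: (roe_bounded_support rA).
Qed.

End spatial.

Lemma spatial_implementation_sym (R : realType) (X Y : metricType R)
    (H K : innerType R) (A : set (l2 X H -> l2 X H))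
    (B : set (l2 Y K -> l2 Y K))
    U V : spatial_implementation A B U V -> spatial_implementation B A V U.
Proof.
case=> bU bV UV U0 V0 AB BA; split => // w u bw bu.
by rewrite innerC -UV// -innerC.
Qed.

(** * Uniform propagation of the implementing unitary *)

Section uniform_propagation.
Context {R : realType} {X Y : metricType R} {H : hilbertType R}
  {K : innerType R}.
Variables (A : set (l2 X H -> l2 X H)) (B : set (l2 Y K -> l2 Y K)).
Variables (U : l2 X H -> l2 Y K) (V : l2 Y K -> l2 X H).
Hypotheses (rA : roe_type_algebra A) (rB : roe_type_algebra B).
Hypothesis UV : spatial_implementation A B U V.
Hypothesis gX : bounded_geometry X.

Lemma inner_spatial_delta x h y k :
  inner (U (l2_delta x h) y) k = inner h (V (l2_delta y k) x).
Proof.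
rewrite -inner_deltar (spatial_inner UV) ?inner_deltal//.
  exact: l2_delta_bounded_support.
exact: l2_delta_bounded_support.
Qed.

(** Otherwise some V (delta_y k), with y arbitrarily far from y0, has a nonzero
    coordinate w n at x. A vector h orthogonal to no w n would give
    U (delta_x h) an unbounded support. *)
Lemma point_image_bounded (y0 : Y) x : exists r, forall h y,
  U (l2_delta x h) y != 0 -> mdist y0 y <= r.
Proof.
apply: contrapT => /forallNP far.
have /choice[hy hyP] (n : nat) : exists hy : H * Y,
    U (l2_delta x hy.1) hy.2 != 0 /\ n%:R < mdist y0 hy.2.
  apply: contrapT => nhy; apply: (far n%:R) => h y Uy.
  by rewrite leNgt; apply: contra_notN nhy => ny; exists (h, y).
pose w n := V (l2_delta (hy n).2 (U (l2_delta x (hy n).1) (hy n).2)) x.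
have [n|h hw] := @avoid_hyperplanes _ _ w.
  have [Uy _] := hyP n; move: Uy; apply: contraNneq => wn0.
  by rewrite -inner_eq0 inner_spatial_delta -/(w n) wn0 inner0r.
have [r rP] : exists r, forall y, U (l2_delta x h) y != 0 -> mdist y0 y <= r.
  apply: bounded_support_radius; apply: (spatial_support UV).
  exact: l2_delta_bounded_support.
have [n rn] : exists n : nat, r < n%:R.
  by exists (Num.truncn r).+1; rewrite truncnS_gt.
have : mdist y0 (hy n).2 <= r.
  apply: rP; move: (hw n); rewrite /w -inner_spatial_delta.
  by apply: contraNneq => ->; rewrite inner0l.
by apply/negP; rewrite -ltNge; apply: lt_trans rn _; case: (hyP n).
Qed.

Lemma ball_image_bounded (x0 : X) (y0 : Y) (r : R) : exists s : R,
  forall x h y, mdist x0 x <= r -> U (l2_delta x h) y != 0 -> mdist y0 y <= s.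
Proof.
have [f fP] := choice (point_image_bounded y0).
have [N NP] := gX (normr_ge0 r).
have /finite_seqP[s sE] : finite_set [set y | mdist x0 y <= `|r|].
  exact: card_le_finite (NP x0) (finite_II N).
exists (\sum_(x <- s) `|f x|) => x h y xr Uy.
apply: (le_trans (fP _ _ _ Uy)); apply: (le_trans (ler_norm _)).
have xs : x \in s.
  by have : [set` s] x by rewrite -sE /= (le_trans xr)// ler_norm.
by rewrite (big_rem x xs)/= lerDl sumr_ge0.
Qed.

(** A probe p singles out one place where the unitary U spreads mass: the image
    of delta_(src p) (vec p) is looked at in the coordinate tgt p. *)
Record probe := Probe { src : X ; vec : H ; tgt : Y }.
Implicit Types p q : probe.

Definition probe_image p : l2 Y K := U (l2_delta (src p) (vec p)).
Definition probe_test p : l2 Y K := l2_delta (tgt p) (probe_image p (tgt p)).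
Definition hits p := rnorm (vec p) = 1 /\ probe_image p (tgt p) != 0.
(** Testing against the point mass probe_test q, instead of asking whether two
    supports meet, lets an overlap be read on either side of the unitary: see
    [overlapE]. *)
Definition overlap p q : R[i] := inner (probe_image p) (probe_test q).

Lemma overlap_target p q : overlap p q != 0 -> probe_image p (tgt q) != 0.
Proof.
by rewrite /overlap inner_deltar; apply: contraNneq => ->; rewrite inner0l.
Qed.

Lemma overlapE p q : overlap p q = inner (vec p) (V (probe_test q) (src p)).
Proof. by rewrite /overlap inner_deltar inner_spatial_delta. Qed.

Lemma overlap_source p q : overlap p q != 0 -> V (probe_test q) (src p) != 0.
Proof. by rewrite overlapE; apply: contraNneq => ->; rewrite inner0r. Qed.

Lemma overlap_diag p : hits p -> overlap p p != 0.
Proof. by case=> _ pp; rewrite /overlap inner_deltar inner_eq0. Qed.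

Lemma exists_hit x h y : U (l2_delta x h) y != 0 ->
  exists2 p, hits p & src p = x /\ tgt p = y.
Proof.
move=> Uy; set k := U (l2_delta x h) y.
have hk : inner h (V (l2_delta y k) x) != 0 :> R[i].
  by rewrite -inner_spatial_delta inner_eq0.
have h0 : h != 0 by apply: contraNneq hk => ->; rewrite inner0l.
have c0 : (rnorm h)^-1%:C%C != 0 :> R[i].
  by rewrite fmorph_eq0 invr_eq0 gt_eqF ?rnorm_gt0.
exists (Probe x ((rnorm h)^-1%:C%C *: h) y) => //; split => /=.
  rewrite rnormZ ger0_norm ?ler0c ?invr_ge0 ?rnorm_ge0//= mulVf//.
  by rewrite gt_eqF ?rnorm_gt0.
apply: contra_neq hk => Uc; apply: (mulfI c0).
by rewrite -innerZl -inner_spatial_delta mulr0 [U _ _]Uc inner0l.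
Qed.

Definition admissible (r : R) (t : probe * probe) :=
  [/\ hits t.1, hits t.2 & mdist (src t.1) (src t.2) <= r].

(** For the operator T with one rank one term per pair, the entry tested by the
    pair t receives from the term of t' the product of overlap t'.1 t.1 and the
    conjugate of overlap t'.2 t.2. The two last conditions make the cross terms
    vanish in both directions. They are asymmetric because a later pair can be
    placed outside the bounded set of sources seen by the earlier one,
    whereas the two targets of the later pair can only be kept from being
    jointly close to the images of the earlier one. *)
Definition decoupled (t t' : probe * probe) :=
  [/\ src t'.1 != src t.1, src t'.2 != src t.2, overlap t'.1 t.1 = 0 &
      overlap t.1 t'.1 = 0 \/ overlap t.2 t'.2 = 0].

(** If one source of t' is close to t, so is the other one, and both targets lie
    in a fixed ball: this excludes the first three failures. If both targets
    lie in the supports of the images of t, they are again in a fixed ball. *)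
Lemma far_decoupled r t : exists N, forall t', admissible r t' ->
  N < mdist (tgt t'.1) (tgt t'.2) -> decoupled t t'.
Proof.
case: t => p q; set x0 := src p; set y0 := tgt p.
have img s : bounded_support (probe_image s).
  by apply: (spatial_support UV); exact: l2_delta_bounded_support.
have [a aP] : exists a, forall x, V (probe_test p) x != 0 -> mdist x0 x <= a.
  apply/bounded_support_radius/(spatial_support_inv UV).
  exact: l2_delta_bounded_support.
have [b bP] := bounded_support_radius y0 (img p).
have [c cP] := bounded_support_radius y0 (img q).
have [s sP] := ball_image_bounded x0 y0 (`|a| + mdist x0 (src q) + `|r|).
exists (Num.max (s + s) (b + c)) => -[p' q'] [/= [p1 pp] [q1 qq] pq].
rewrite gt_max => /andP[far1 far2].
(* The sources of t' cannot both lie in a ball of this radius around x0. *)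
have far : mdist x0 (src p') <= `|a| + mdist x0 (src q) + `|r| ->
    mdist x0 (src q') <= `|a| + mdist x0 (src q) + `|r| -> False.
  move=> p's q's; move: far1; apply/negP; rewrite -leNgt.
  rewrite (le_trans (metric_triangle _ y0 _))// lerD//.
    by rewrite metric_sym (sP _ _ _ p's pp).
  exact: sP q's qq.
have a0 := normr_ge0 a; have la := ler_norm a; have lr := ler_norm r.
have r0 := normr_ge0 r; have d0 := mdist_ge0 x0 (src q).
have q'p' : mdist x0 (src q') <= mdist x0 (src p') + r.
  by rewrite (le_trans (metric_triangle _ (src p') _))// lerD2l.
have p'q' : mdist x0 (src p') <= mdist x0 (src q') + r.
  by rewrite (le_trans (metric_triangle _ (src q') _))// lerD2l metric_sym.
split => /=.
- apply/eqP => p'x0; apply: far; last apply: (le_trans q'p');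
    by rewrite p'x0 mdistxx; lra.
- apply/eqP => q'q; apply: far; first apply: (le_trans p'q');
    by rewrite q'q; lra.
- apply/eqP; apply: contrapT => /negP/overlap_source/aP p'a.
  by apply: far; first lra; apply: (le_trans q'p'); lra.
- have [->|/overlap_target/bP p'b] := eqVneq (overlap p p') 0; first by left.
  have [->|/overlap_target/cP q'c] := eqVneq (overlap q q') 0; first by right.
  exfalso; move: far2; apply/negP; rewrite -leNgt.
  by rewrite (le_trans (metric_triangle _ y0 _))// lerD// metric_sym.
Qed.

(** The weighted translation with terms dyad (delta_{p_n}) (delta_{q_n}), where
    (p_n, q_n) = t n, lies in A. The element S of B that it corresponds to has,
    between the targets of t n, the n-th term as its only contribution; so
    S would have infinite propagation. *)
Lemma no_gliding_hump r (t : nat -> probe * probe) :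
  (forall n, admissible r (t n)) ->
  (forall i j, (i < j)%N -> decoupled (t i) (t j)) ->
  ~ (forall n, n%:R < mdist (tgt (t n).1) (tgt (t n).2)).
Proof.
move=> adm dec far.
pose px n := src (t n).1; pose qx n := src (t n).2.
have xinj (f : nat -> X) : (forall i j, (i < j)%N -> f j != f i) -> injective f.
  move=> fI i j ij; case: (ltngtP i j) => // /fI; by rewrite ij eqxx.
have pI : injective px by apply: xinj => i j /dec[].
have qI : injective qx by apply: xinj => i j /dec[].
pose idx x := xget 0%N [set n | px n = x].
have idxK n : idx (px n) = n.
  by apply: pI; rewrite /idx; exact: (@xgetI _ 0 [set m | px m = px n] n).
pose a x := if px (idx x) == x then vec (t (idx x)).1 else 0.
have aP x : a x != 0 -> px (idx x) = x.
  by rewrite /a; have [//|_] := eqVneq (px (idx x)) x; rewrite eqxx.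
pose b x := vec (t (idx x)).2.
have sI x y : a x != 0 -> a y != 0 -> qx (idx x) = qx (idx y) -> x = y.
  by move=> /aP <- /aP <-; rewrite !idxK => /qI ->.
have a1 x : rnorm (a x) <= 1.
  rewrite /a; case: ifP => _; last by rewrite rnorm0.
  by have [[-> _] _ _] := adm (idx x).
have b1 x : rnorm (b x) <= 1 by have [_ [-> _] _] := adm (idx x).
have AT : A (weighted_translation sI a1 b1).
  apply: (@roe_weighted_translation _ _ _ _ rA _ _ _ sI a1 b1 r) => x /aP xE.
  by rewrite -{1}xE; have [_ _] := adm (idx x).
have [S BS SP] := spatial_image UV AT.
have [s s0 sS] := roe_finite_propagation rB BS.
have [n sn] : exists n : nat, s < n%:R.
  by exists (Num.truncn s).+1; rewrite truncnS_gt.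
have := SP _ _ (l2_delta_bounded_support (tgt (t n).2) _)
               (l2_delta_bounded_support (tgt (t n).1) _).
move=> /(_ (probe_image (t n).2 (tgt (t n).2))
           (probe_image (t n).1 (tgt (t n).1))).
rewrite inner_deltar.
rewrite -[X in inner X _ = _]/(matrix_coef S (tgt (t n).1) (tgt (t n).2) _).
rewrite sS; last exact/ltW/(lt_trans sn).
rewrite inner0l => /esym.
rewrite -/(probe_test (t n).1) -/(probe_test (t n).2).
(* The contribution of the m-th term to the entry tested by the n-th pair. *)
have coef m :
  inner (weighted_translation sI a1 b1 (V (probe_test (t n).2)) (px m))
    (V (probe_test (t n).1) (px m)) =
    (overlap (t m).2 (t n).2)^* * overlap (t m).1 (t n).1.
  rewrite weighted_translationE innerZl /a /b idxK eqxx.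
  by rewrite !overlapE -innerC.
rewrite (@inner_l2_single _ _ _ _ _ (px n)).
  rewrite coef => /eqP; apply/negP.
  by rewrite mulf_neq0 ?conjC_eq0// overlap_diag//; have [] := adm n.
move=> x; have [ax0 _|/aP <-] := eqVneq (a x) 0.
  by rewrite weighted_translationE ax0 scaler0 inner0l.
set m := idx x => mn; rewrite coef.
case: (ltngtP m n) => [/dec[_ _ _ [->|->]]|/dec[_ _ -> _]|mE].
- by rewrite mulr0.
- by rewrite rmorph0 mul0r.
- by rewrite mulr0.
- by rewrite mE eqxx in mn.
Qed.

(** Otherwise there are admissible pairs with targets arbitrarily far apart, once
    vectors are normalised; choosing them successively beyond the thresholds of
    [far_decoupled] produces a gliding hump. *)
Lemma uniform_propagation r : exists2 s : R, 0 < s & forall x x' h h' y y',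
  mdist x x' <= r ->
  U (l2_delta x h) y != 0 -> U (l2_delta x' h') y' != 0 -> mdist y y' <= s.
Proof.
apply: contrapT => nprop.
have /choice[far farP] (N : R) : exists t, admissible r t /\
    N < mdist (tgt t.1) (tgt t.2).
  apply: contrapT => nt; apply: nprop; exists (Num.max N 1).
    by rewrite lt_max ltr01 orbT.
  move=> x x' h h' y y' xx' Uy Uy'; rewrite le_max leNgt.
  have [p hp [px py]] := exists_hit Uy.
  have [q hq [qx qy]] := exists_hit Uy'.
  apply/orP; left; apply: contra_notN nt => Ny; exists (p, q).
  by rewrite /admissible /= px qx py qy.
have /choice[sep sepP] := far_decoupled r.
(* N is nondecreasing, at least n, and past each separation threshold used so
   far; far (N n) is then decoupled from all earlier choices. *)
pose fix N n := if n is m.+1 then Num.max (N m + 1) (sep (far (N m))) else 0.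
apply: (@no_gliding_hump r (far \o N)) => [n|i j|n] /=.
- by have [] := farP (N n).
- move=> ij; apply: sepP; have [// _ +] := farP (N j).
  apply: le_lt_trans.
  elim: j ij => // j IH; rewrite ltnS leq_eqVlt => /predU1P[->|/IH ij] /=.
    by rewrite le_max lexx orbT.
  by rewrite le_max (le_trans ij)// lerDl.
- have [_] := farP (N n); apply: le_lt_trans.
  elim: n => //= n IH; by rewrite le_max -natr1 lerD2r IH.
Qed.
End uniform_propagation.

(** * From the unitary to a coarse equivalence *)

(** Over an empty space the algebra is zero, while a point of Y gives a nonzero
    rank one operator in B. *)
Lemma star_isomorphism_point (R : realType) (X Y : metricType R)
    (H K : innerType R) (A : set (l2 X H -> l2 X H))
    (B : set (l2 Y K -> l2 Y K))
    phi (y : Y) (k : K) :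
  roe_type_algebra A -> roe_type_algebra B -> star_isomorphism A B phi ->
  k != 0 -> exists x : X, True.
Proof.
move=> rA rB iphi k0; apply: contrapT => /forallNP X0.
have d0 := l2_delta_neq0 y k0; have bd := l2_delta_bounded_support y k.
have [_ _ /(_ _ (roe_dyad rB bd bd))[T _ phiT]] := star_isomorphism_bij iphi.
have T0 : T = 0 by apply/funext => u; apply: l2_ext => x; case: (X0 x).
have := congr1 (fun S => S (l2_delta y k)) phiT.
rewrite T0 (star_isomorphism0 rA iphi) => /esym/eqP.
by rewrite scaler_eq0 inner_eq0 orbb (negbTE d0).
Qed.

(** With x = g y, the vector h' = V (delta_y k) x is nonzero, and
    <U (delta_x h') y, k> = <h', h'>. Hence y lies in the support of
    U (delta_x h'), and uniform propagation at distance 0 compares it with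
    f x, which lies in the support of U (delta_x h). The other composite is
    treated alike, with the vector U (delta_x h) (f x) in place of k. *)
Lemma spatial_coarsely_equivalent (R : realType) (X Y : metricType R)
    (H K : hilbertType R) (A : set (l2 X H -> l2 X H))
    (B : set (l2 Y K -> l2 Y K)) U V (h : H) (k : K) :
  bounded_geometry X -> bounded_geometry Y -> h != 0 -> k != 0 ->
  roe_type_algebra A -> roe_type_algebra B ->
  spatial_implementation A B U V -> coarsely_equivalent X Y.
Proof.
move=> gX gY h0 k0 rA rB UV; have VU := spatial_implementation_sym UV.
have /choice[f fP] (x : X) : exists y, U (l2_delta x h) y != 0.
  apply/l2_neq0/(spatial_neq0 UV); last exact: l2_delta_neq0.
  exact: l2_delta_bounded_support.
have /choice[g gP] (y : Y) : exists x, V (l2_delta y k) x != 0.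
  apply/l2_neq0/(spatial_neq0 VU); last exact: l2_delta_neq0.
  exact: l2_delta_bounded_support.
exists f, g; split.
- move=> r _; have [s s0 sP] := uniform_propagation rA rB UV gX r.
  by exists s => // x x' xx'; exact: sP xx' (fP x) (fP x').
- move=> r _; have [s s0 sP] := uniform_propagation rB rA VU gY r.
  by exists s => // y y' yy'; exact: sP yy' (gP y) (gP y').
- have [s s0 sP] := uniform_propagation rA rB UV gX 0.
  exists s => // y; set x := g y.
  suff Uxy : U (l2_delta x (V (l2_delta y k) x)) y != 0.
    by apply: sP _ (fP x) Uxy; rewrite mdistxx.
  have : inner (V (l2_delta y k) x) (V (l2_delta y k) x) != 0 :> R[i].
    by rewrite inner_eq0; exact: gP.
  rewrite -(inner_spatial_delta UV).
  by apply: contraNneq => ->; rewrite inner0l.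
- have [s s0 sP] := uniform_propagation rB rA VU gY 0.
  exists s => // x; set y := f x.
  suff Vyx : V (l2_delta y (U (l2_delta x h) y)) x != 0.
    by apply: sP _ (gP y) Vyx; rewrite mdistxx.
  have : inner (U (l2_delta x h) y) (U (l2_delta x h) y) != 0 :> R[i].
    by rewrite inner_eq0; exact: fP.
  rewrite (inner_spatial_delta UV).
  by apply: contraNneq => ->; rewrite inner0r.
Qed.

Theorem theorem5p1 (R : realType) (X Y : metricType R) (H K : hilbertType R)
    (A : set (l2 X H -> l2 X H)) (B : set (l2 Y K -> l2 Y K)) :
  bounded_geometry X -> bounded_geometry Y ->
  separable_space H -> (exists v : H, v != 0) ->
  separable_space K -> (exists v : K, v != 0) ->
  roe_type_algebra A -> roe_type_algebra B ->
  (exists phi : (l2 X H -> l2 X H) -> (l2 Y K -> l2 Y K),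
    star_isomorphism A B phi) ->
  coarsely_equivalent X Y.
Proof.
move=> gX gY _ [h h0] _ [k k0] rA rB [phi iphi].
have [[x _]|/forallNP X0] := pselect (exists x : X, True).
  have [U [V UV]] := exists_spatial_implementation rA rB iphi x h0.
  exact: spatial_coarsely_equivalent gX gY h0 k0 rA rB UV.
have Y0 (y : Y) : False.
  by have [x _] := star_isomorphism_point y rA rB iphi k0; exact: (X0 x).
exists (fun x => False_rect Y (X0 x I)), (fun y => False_rect X (Y0 y)).
by split=> [r _|r _||]; exists 1 => // z; case: (X0 z I) || case: (Y0 z).
Qed.
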